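(* For integers $D,m$ with $m>D\ge 1$ and for every $\varepsilon>0$ there is a $D\times m$ matrix $M$ with entries $a(i,j)$ such that: (1) every $a(i,j)$ is an integer with $a(i,j)\ge 1$, $a(i,j+1)>a(i,j)$ for all $i\in[D]$, $j\in[m-1]$, and $a(i+1,1)>a(i,m)$ for all $i\in[D-1]$; (2) for every $k\in\{2,\ldots,D\}$ and every $k\times k$ submatrix $M^*$ of $M$ (rows $i_1<\dots<i_k$, columns $j_1<\dots<j_k$), with $P=\prod_{l=1}^k a(i_l,j_l)$ the product of the entries on the main diagonal of $M^*$, one has $|\det M^*-P|<\varepsilon P$; (3) $a(i,j-1)\,a(i,j)<\varepsilon\, a(i,j+1)$ for all $i\in[D]$ and $j\in\{2,\ldots,m-1\}$. *)

(* Defs.v *)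
From HB Require Import structures.
From mathcomp Require Export all_boot all_order all_algebra.
From mathcomp Require Export reals.

#[export] Set Implicit Arguments.
#[export] Unset Strict Implicit.
#[export] Unset Printing Implicit Defensive.

Export Order.TTheory GRing.Theory Num.Theory.

(* Main.v *)
Require Import Defs.
From mathcomp Require Import all_boot all_order all_algebra.
From mathcomp Require Import perm fingroup reals zify.

Local Open Scope ring_scope.

(** Take [a(i,j) = B ^ (2^(i m) * 2^j)] for a large integer [B], rows and
columns being numbered from 0.  The exponent is a product of an increasing
function of the row and an increasing function of the column, so by the strict
rearrangement inequality the diagonal term of the Leibniz expansion of any
minor exceeds every other term by a factor of at least [B]; there are at most
[D!] terms, so [B > D!/eps] suffices. *)

(** Let [l] be the least moved point. All smaller points are fixed, so neither the image nor the
    preimage of [l] can lie below it; hence [l] and its preimage form an inversion. *)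
Lemma perm_neq1_inversion (k : nat) (s : 'S_k) : s != 1%g ->
  exists l l' : 'I_k, (l < l')%N /\ (s l' < s l)%N.
Proof.
move=> s_neq1; have /existsP[x0 moved_x0] : [exists x, s x != x].
  apply: contra_neqT s_neq1 => /existsPn fixed_s.
  by apply/permP=> x; rewrite perm1; apply/eqP/negPn/fixed_s.
case: (@arg_minnP _ x0 (fun x => s x != x) val moved_x0) => l moved_l min_l.
have fixed (x : 'I_k) : (x < l)%N -> s x = x.
  by move=> lt_xl; apply: contraTeq lt_xl => /min_l; rewrite -leqNgt.
have lt_l_sl : (l < s l)%N.
  rewrite ltn_neqAle eq_sym moved_l /= leqNgt.
  by apply/negP=> /fixed/perm_inj sl; rewrite sl eqxx in moved_l.
exists l, ((s^-1)%g l); rewrite permKV; split=> //.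
rewrite ltnNge leq_eqVlt negb_or; apply/andP; split.
  apply/eqP=> /val_inj sVl.
  by move: moved_l; rewrite -{1}sVl permKV eqxx.
by apply/negP=> lt_l; move: (lt_l); rewrite -(fixed _ lt_l) permKV ltnn.
Qed.

(** Undoing an inversion strictly increases the sum, so a maximizing permutation, which exists by
    finiteness, can only be the identity. Strictness at [s] comes from improving [s] once before
    comparing with the maximum. *)
Lemma rearrangement_ltn (k : nat) (u v : 'I_k -> nat) (s : 'S_k) :
  {homo u : l l' / (l < l')%N} -> {homo v : l l' / (l < l')%N} ->
  s != 1%g -> (\sum_l u l * v (s l) < \sum_l u l * v l)%N.
Proof.
move=> u_incr v_incr s_neq1; pose S (t : 'S_k) := (\sum_l u l * v (t l))%N.
have improve (t : 'S_k) : t != 1%g -> exists t', (S t < S t')%N.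
  move=> /perm_neq1_inversion[l [l' [lt_l lt_t]]].
  exists (tperm l l' * t)%g; rewrite /S.
  have neq_l : l' != l by rewrite neq_ltn lt_l orbT.
  rewrite (bigD1 l) //= (bigD1 l') //=.
  rewrite [ltnRHS](bigD1 l) //= [X in (_ < _ + X)%N](bigD1 l') //=.
  rewrite !permM tpermL tpermR !addnA.
  rewrite [X in (_ < _ + X)%N](eq_bigr (fun i => u i * v (t i)))%N; last first.
    by move=> i /andP[? ?]; rewrite permM tpermD // eq_sym.
  (* The gain from the swap is [(u l' - u l) * (v (t l) - v (t l'))], a product of two positive
     factors. *)
  rewrite ltn_add2r; have := u_incr _ _ lt_l; have := v_incr _ _ lt_t; nia.
have [t' lt_st'] := improve s s_neq1.
case: (@arg_maxnP _ (1%g : 'S_k) xpredT S) => // t _ max_t.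
have t1 : t = 1%g.
  apply: contraTeq isT => /improve[t'' lt_tt''].
  have : (S t'' <= S t)%N := max_t t'' isT.
  by rewrite leqNgt lt_tt''.
suff <- : S 1%g = (\sum_l u l * v l)%N.
  by apply: leq_trans lt_st' _; rewrite -t1; apply: max_t.
by apply: eq_bigr => i _; rewrite perm1.
Qed.

(** Exponents are integers, so a strictly smaller one is smaller by at least 1: each off-diagonal
    Leibniz term times [b] is at most the diagonal term. Multiplying by [b] on the left avoids
    division, so the bound applies over [int]. *)
Lemma det_exp_rank1_near_diag (R : numDomainType) (k : nat) (u v : 'I_k -> nat)
    (b : R) :
  {homo u : l l' / (l < l')%N} -> {homo v : l l' / (l < l')%N} -> 1 <= b ->
  `|\det (\matrix_(i, j) b ^+ (u i * v j)) - b ^+ (\sum_l u l * v l)| * b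
  <= k`!%:R * b ^+ (\sum_l u l * v l).
Proof.
move=> u_incr v_incr b_ge1; set P := b ^+ (\sum_l _); have b_ge0 : 0 <= b := le_trans ler01 b_ge1.
have termE (s : 'S_k) :
    \prod_i (\matrix_(i, j) b ^+ (u i * v j)) i (s i)
    = b ^+ (\sum_l u l * v (s l)).
  by rewrite -prodrXr; apply: eq_bigr => i _; rewrite mxE.
have term1 : b ^+ (\sum_l u l * v ((1%g : 'S_k) l)) = P.
  by congr (_ ^+ _); apply: eq_bigr => i _; rewrite perm1.
rewrite /determinant (bigD1 1%g) //= odd_perm1 mul1r termE term1.
rewrite [P + _]addrC addrK; apply: le_trans (_ : \sum_(s : 'S_k | s != 1%g) P <= _).
  apply: le_trans (ler_wpM2r b_ge0 (ler_norm_sum _ _ _)) _.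
  rewrite mulr_suml; apply: ler_sum => s s_neq1.
  rewrite termE normrM normr_sign mul1r ger0_norm ?exprn_ge0 // -exprSr.
  by apply: ler_weXn2l => //; apply: rearrangement_ltn.
have P_ge0 : 0 <= P by apply: exprn_ge0.
rewrite sumr_const -[P *+ _]mulr_natl ler_wpM2r // ler_nat.
by rewrite -card_Sn; apply/subset_leq_card/subsetP.
Qed.

Theorem theorem6p1 (R : realType) (D m : nat) (hD : (1 <= D)%N) (hm : (D < m)%N)
    (eps : R) (heps : 0 < eps) :
  exists M : 'M[int]_(D, m),
    [/\ [/\ forall (i : 'I_D) (j : 'I_m), 1 <= M i j,
            forall (i : 'I_D) (j j' : 'I_m),
              nat_of_ord j' = (nat_of_ord j).+1 -> M i j < M i j'
          & forall (i i' : 'I_D) (jfirst jlast : 'I_m),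
              nat_of_ord i' = (nat_of_ord i).+1 ->
              nat_of_ord jfirst = 0%N -> nat_of_ord jlast = m.-1 ->
              M i jlast < M i' jfirst],
        forall (k : nat) (r : 'I_k -> 'I_D) (c : 'I_k -> 'I_m),
          (2 <= k <= D)%N ->
          {homo r : l l' / (l < l')%N} -> {homo c : l l' / (l < l')%N} ->
          let P : int := \prod_(l < k) M (r l) (c l) in
          `|(\det (mxsub r c M))%:~R - P%:~R| < eps * P%:~R
      & forall (i : 'I_D) (jprev j jnext : 'I_m),
          nat_of_ord j = (nat_of_ord jprev).+1 ->
          nat_of_ord jnext = (nat_of_ord j).+1 ->
          (M i jprev * M i j)%:~R < eps * (M i jnext)%:~R].
Proof.
(* [Num.bound] gives an integer above [D!/eps]; the two successors also force [B > 1], which strict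
   monotonicity of powers needs. *)
pose B := (Num.bound (D`!%:R / eps)).+2.
have B_eps : D`!%:R < eps * B%:R.
  rewrite mulrC -ltr_pdivrMr //; apply: lt_trans (archi_boundP _) _.
    by rewrite divr_ge0 // ltW.
  by rewrite ltr_nat.
have eps_B : 1 < eps * B%:R.
  by apply: le_lt_trans B_eps; rewrite ler1n fact_gt0.
have B_gt0 : 0 < B%:R :> R by rewrite ltr0n.
have B_gt1 : 1 < B%:Z by [].
have B_ge1 : 1 <= B%:Z by [].
pose u (i : nat) := (2 ^ (i * m))%N; pose v (j : nat) := (2 ^ j)%N.
have uvE i j : (u i * v j = 2 ^ (i * m + j))%N by rewrite expnD.
exists (\matrix_(i, j) B%:Z ^+ (u i * v j)).
split; first split.
- by move=> i j; rewrite mxE exprn_ege1.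
- move=> i j j' jj'; rewrite !mxE ltr_eXn2l // !uvE ltn_exp2l //.
  by rewrite jj' addnS.
(* [i * m + j] numbers the entries row by row, so the last entry of a row and the first of the next
   have consecutive numbers. *)
- move=> i i' j0 j1 ii' j00 j1m; rewrite !mxE ltr_eXn2l // !uvE ltn_exp2l //.
  by rewrite ii' j00 j1m mulSn; lia.
- move=> k r c /andP[_ le_kD] r_incr c_incr /=.
  set P := \prod_(l < k) _.
  pose ur l := u (r l); pose vc l := v (c l).
  have m_gt0 : (0 < m)%N by apply: leq_trans hm.
  have ur_incr : {homo ur : l l' / (l < l')%N}.
    by move=> l l' /r_incr lt_r; rewrite ltn_exp2l // ltn_pmul2r.
  have vc_incr : {homo vc : l l' / (l < l')%N}.
    by move=> l l' /c_incr lt_c; rewrite ltn_exp2l.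
  have := det_exp_rank1_near_diag ur_incr vc_incr B_ge1.
  have -> : B%:Z ^+ (\sum_l ur l * vc l) = P.
    by rewrite -prodrXr; apply: eq_bigr => i _; rewrite mxE.
  have -> : \matrix_(i, j) B%:Z ^+ (ur i * vc j)
            = mxsub r c (\matrix_(i < D, j < m) B%:Z ^+ (u i * v j)).
    by apply/matrixP=> i j; rewrite !mxE.
  rewrite /= -(ler_int R) !intrM intr_norm intrB natz -!pmulrn => near_diag.
  have P_gt0 : 0 < P%:~R :> R.
    by rewrite ltr0z; apply: prodr_gt0 => i _; rewrite mxE exprn_gt0.
  (* After scaling by [B], it remains to use [k! <= D! < eps * B]. *)
  rewrite -(ltr_pM2r B_gt0); apply: le_lt_trans near_diag _.
  rewrite mulrAC ltr_pM2r //; apply: le_lt_trans B_eps.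
  by rewrite ler_nat leq_fact.
- move=> i j0 j j1 jj0 j1j; rewrite !mxE -exprD.
  set e := (X in X%:~R < _); set f := (X in eps * X%:~R).
  have e_gt0 : 0 < e%:~R :> R by rewrite ltr0z exprn_gt0.
  (* With [n = i * m + j0], the exponents satisfy [2^n + 2^(n+1) + 1 <= 2^(n+2)], because
     [2^n >= 1]. The spare factor [B] then absorbs [eps], as [eps * B > 1]. *)
  have le_eBf : e%:~R * B%:R <= f%:~R :> R.
    rewrite pmulrn -intrM ler_int -exprSr ler_weXn2l // !uvE j1j jj0.
    by rewrite !addnS !expnS; have := expn_gt0 2 (i * m + j0); lia.
  apply: lt_le_trans (ler_wpM2l (ltW heps) le_eBf).
  by rewrite mulrCA -[ltLHS]mulr1 ltr_pM2l.
Qed.
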